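(* Let $I\subset\mathbb R$ be a non-degenerate interval, let $N\ge 1$ be an integer and let $a_0,\ldots,a_N\in\mathbb R$ with $a_0\ne 0$ and $a_N\neq 0$. Assume that $$\mathcal R(a_N,\ldots,a_0)=\{(\lambda_1,l_1),\ldots,(\lambda_p,l_p),(\mu_1,k_1),(\overline{\mu_1},k_1),\ldots,(\mu_q,k_q),(\overline{\mu_q},k_q)\}$$ and that $$|\lambda_1|\le\ldots\le|\lambda_p|<|\mu_1|\le\ldots\le|\mu_q|.$$ Let $b_Mr^M+\ldots+b_1r+b_0$ be a polynomial with real coefficients, $b_M\ne0$, such that $$\mathcal R(b_M,\ldots,b_0)=\{(\lambda_1,l_1),\ldots,(\lambda_p,l_p)\}.$$ Then a continuous function $g\colon I\to I$ satisfies $$a_Ng^N(x)+\ldots+a_1g(x)+a_0x=0\quad\text{for all }x\in I$$ if and only if it satisfies $$b_Mg^M(x)+\ldots+b_1g(x)+b_0x=0\quad\text{for all }x\in I.$$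
   Context: $g^n$ denotes the $n$-th iterate of $g$. For real numbers $c_0,\ldots,c_K$ with $c_K\neq0$, $\mathcal R(c_K,\ldots,c_0)$ denotes the set $\{(r_1,k_1),\ldots,(r_s,k_s)\}$ of all pairs consisting of a complex root of the polynomial $c_Kr^K+\ldots+c_1r+c_0$ and its multiplicity, where $r_1,\ldots,r_s$ are the pairwise distinct complex roots. All roots listed in $\mathcal R$ are pairwise distinct; in particular, the listing of both $(\mu_j,k_j)$ and $(\overline{\mu_j},k_j)$ forces each $\mu_j$ to be non-real. Here $p,q$ are non-negative integers, and the inequality chain is read with the absent terms omitted. *)

(* Defs.v *)
From HB Require Import structures.
From mathcomp Require Import all_boot all_order all_algebra.
From mathcomp Require Import complex.
From mathcomp Require Import all_classical all_reals all_analysis.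

Set Implicit Arguments.
Unset Strict Implicit.
Unset Printing Implicit Defensive.

Import Order.TTheory GRing.Theory Num.Theory.
Import numFieldNormedType.Exports.

Local Open Scope classical_set_scope.
Local Open Scope ring_scope.

(* Only the values c 0, ..., c K are used. *)
Definition cpoly (R : realType) (K : nat) (c : nat -> R) : {poly R[i]} :=
  \poly_(j < K.+1) (c j)%:C%C.

(* [mup r p] is meaningful only for p != 0, i.e. when some c j is nonzero. *)
Definition roots_mult (R : realType) (K : nat) (c : nat -> R) :
    set (R[i] * nat) :=
  [set rk | root (cpoly K c) rk.1 /\ rk.2 = mup rk.1 (cpoly K c)].

Definition listing (R : realType) (p : nat)
    (lam : 'I_p -> R[i]) (l : 'I_p -> nat) : seq (R[i] * nat) :=
  [seq (lam i, l i) | i <- enum 'I_p].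

Definition iter_eq (R : realType) (I : set R) (K : nat) (c : nat -> R)
    (g : R -> R) : Prop :=
  forall x, I x -> \sum_(j < K.+1) c j * iter j g x = 0.

(* Main.v *)
(* The equation at coefficients a says that the functional L_x : X^j |-> g^j(x) kills
   the ideal generated by the characteristic polynomial A. It makes g injective, hence
   monotone, so g^2 is increasing, and for fixed m the differences
   d_(m+2j) = g^(m+2j+1)(x) - g^(m+2j)(x) have a sign independent of j. Write A = B C up
   to a scalar, where C collects the roots mu and their conjugates. As these are not real,
   C divides P(X^2) for some monic P with nonnegative coefficients, say of degree n. Then
   |d_(m+2n)| is at most the modulus of P(S^2) d at m (S the shift), and the latter
   sequence is annihilated by B(S), hence is O(sigma^m) with |lambda| < sigma < |mu|.
   So B(S) d is O(sigma^m) while C(S) kills its shift, which forces B(S) d = 0 from rank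
   2n on; finally X^(2n) (X - 1) is coprime to C, so L_x kills the ideal of B. *)
Require Import Defs.
From HB Require Import structures.
From mathcomp Require Import all_boot all_order all_algebra.
From mathcomp Require Import complex ring lra.
From mathcomp Require Import all_classical all_reals all_analysis.

Set Implicit Arguments.
Unset Strict Implicit.
Unset Printing Implicit Defensive.

Import Order.TTheory GRing.Theory Num.Theory.
Import numFieldNormedType.Exports.
Local Open Scope classical_set_scope.
Local Open Scope ring_scope.

(** * Monic polynomials with nonnegative coefficients and prescribed roots *)

(* Squaring at least doubles |Im z| / Re z as long as Re z > 0. *)
Lemma exists_exp_Re_le0 (R : rcfType) (n : nat) (z : R[i]) :
  complex.Re z <= `|complex.Im z| * 2 ^+ n ->
  exists2 k, (0 < k)%N & complex.Re (z ^+ k) <= 0.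
Proof.
elim: n z => [|n IHn] [x y] /= le_xy.
  have [x_le0|x_gt0] := leP x 0; first by exists 1%N.
  exists 2%N => //; rewrite expr2 /= subr_le0 -!expr2 -[leRHS]real_normK ?num_real//.
  rewrite expr0 mulr1 in le_xy.
  by rewrite ler_sqr ?nnegrE ?normr_ge0 // ltW.
have [x_le0|x_gt0] := leP x 0; first by exists 1%N.
have [k k_gt0 Re_le0] : exists2 k, (0 < k)%N &
    complex.Re (((x +i* y)%C ^+ 2) ^+ k) <= 0.
  apply: IHn; rewrite expr2 /= [y * x]mulrC -mulr2n normrMn normrM gtr0_norm //.
  have -> : x * `|y| *+ 2 * 2 ^+ n = x * (`|y| * 2 ^+ n.+1) by rewrite exprS; ring.
  apply: le_trans (_ : x * x <= _); first by rewrite gerBl -expr2 sqr_ge0.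
  by rewrite ler_pM2l.
by exists (2 * k)%N; rewrite ?muln_gt0 // exprM.
Qed.

(* With Re (z^k) <= 0, the polynomial X^(2k) - 2 Re (z^k) X^k + |z^k|^2 works. *)
Lemma exists_nneg_annihilator (R : realType) (z : R[i]) : ~~ (0 <= z) ->
  exists P : {poly R[i]}, [/\ P \is monic, (forall i, 0 <= P`_i) & root P z].
Proof.
move=> z_nge0.
have [k k_gt0 Re_le0] : exists2 k, (0 < k)%N & complex.Re (z ^+ k) <= 0.
  have [Im0|Im_neq0] := eqVneq (complex.Im z) 0.
    exists 1%N => //; rewrite expr1; move: z_nge0.
    by rewrite lecE Im0 eqxx /= -ltNge => /ltW.
  (* As n < 2^n, any exponent n above the ratio t meets the condition of the previous lemma. *)
  pose t := `|complex.Re z| / `|complex.Im z|.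
  apply: (@exists_exp_Re_le0 _ (Num.Def.archi_bound t)).
  rewrite (le_trans (ler_norm _)) // mulrC -ler_pdivrMr ?normr_gt0 //.
  rewrite ltW // (lt_trans (archi_boundP _)) ?divr_ge0 //.
  by rewrite -natrX ltr_nat ltn_expl.
set w := z ^+ k in Re_le0.
exists (('X^k - w%:P) * ('X^k - (w^*%C)%:P)); split.
- by rewrite rpredM // monicXnsubC.
- have -> : ('X^k - w%:P) * ('X^k - (w^*%C)%:P) =
      'X^k * 'X^k + (- (w + w^*%C))%:P * 'X^k + (`|w| ^+ 2)%:P.
    by rewrite sqr_normc polyCN polyCD polyCM; ring.
  move=> i; rewrite -exprD !coefD coefCM !coefXn coefC !addr_ge0 //.
    by rewrite mulr_ge0 // addcJ oppr_ge0 pmulr_rle0 // lecR.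
  by case: ifP => // _; rewrite exprn_ge0.
- by rewrite rootM /root !hornerE subrr eqxx.
Qed.

(** A polynomial vanishing at z^2 gives, after composition with ['X^2], one vanishing at z. Products
    keep the coefficients nonnegative and account for repeated entries of [rs]. *)
Lemma exists_nneg_multiple (R : realType) (rs : seq R[i]) :
  {in rs, forall z, ~~ (0 <= z ^+ 2)} ->
  exists P : {poly R[i]}, [/\ P \is monic, (forall i, 0 <= P`_i) &
    \prod_(z <- rs) ('X - z%:P) %| P \Po 'X^2].
Proof.
elim: rs => [|z rs IHrs] rs_nge0.
  exists 1; split; rewrite ?rpred1 //; first by move=> i; rewrite coef1.
  by rewrite big_nil dvd1p.
have [y y_rs|P [P_monic P_ge0 dvdP]] := IHrs.
  by apply: rs_nge0; rewrite inE y_rs orbT.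
have [|Q [Q_monic Q_ge0 rootQ]] := exists_nneg_annihilator (z := z ^+ 2).
  by apply: rs_nge0; rewrite inE eqxx.
exists (Q * P); split; first by rewrite rpredM.
  by move=> i; rewrite coefM sumr_ge0 // => j _; rewrite mulr_ge0.
rewrite big_cons comp_polyM dvdp_mul // dvdp_XsubCl.
by rewrite /root horner_comp hornerXn.
Qed.

(** * Growth and decay of the sequences m |-> L (X^m P) *)

Section GeometricBounds.
Context {F : numFieldType}.
Implicit Types (L : {scalar {poly F}}) (P Q : {poly F}) (rs : seq F).

Lemma annihilator_monomials L P :
  (forall m, L ('X^m * P) = 0) -> forall Q, L (Q * P) = 0.
Proof.
move=> LP0 Q; rewrite -[Q]coefK poly_def mulr_suml linear_sum big1 // => i _.
by rewrite -scalerAl linearZ /= LP0 mulr0.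
Qed.

Lemma functional_mulXsubC L P (r : F) m :
  L ('X^m * (('X - r%:P) * P)) = L ('X^(m.+1) * P) - r * L ('X^m * P).
Proof.
have -> : 'X^m * (('X - r%:P) * P) = 'X^(m.+1) * P - r *: ('X^m * P).
  by rewrite exprSr -mul_polyC; ring.
by rewrite linearB linearZ.
Qed.

(** Peeling off one root r leaves a recurrence u_(m+1) = r u_m + v_m, where v_m = O(sigma^m) by
    induction. Strictness of |r| < sigma avoids polynomial factors at repeated roots. *)
Lemma geometric_upper_bound L (sigma : F) rs P : 0 < sigma ->
  {in rs, forall r, `|r| < sigma} ->
  (forall m, L ('X^m * (\prod_(r <- rs) ('X - r%:P) * P)) = 0) ->
  exists2 K, 0 <= K & forall m, `|L ('X^m * P)| <= K * sigma ^+ m.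
Proof.
move=> sigma_gt0; elim: rs P => [|r rs IHrs] P rs_lt LP0.
  exists 0 => // m.
  by have := LP0 m; rewrite big_nil mul1r => ->; rewrite normr0 mul0r.
have [s s_rs|m|K K_ge0 leK] := IHrs (('X - r%:P) * P).
- by apply: rs_lt; rewrite inE s_rs orbT.
- by have := LP0 m; rewrite big_cons -mulrA [('X - _) * _]mulrCA.
have r_lt : 0 < sigma - `|r| by rewrite subr_gt0 rs_lt // inE eqxx.
(* The second summand gives |r| K' + K <= sigma K', which carries the induction; the first covers m
   = 0. *)
pose K' := `|L P| + K / (sigma - `|r|).
have K'_ge0 : 0 <= K' by rewrite addr_ge0 // divr_ge0 // ltW.
exists K' => //; elim=> [|m IHm].
  by rewrite expr0 mul1r mulr1 lerDl divr_ge0 // ltW.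
have -> : L ('X^(m.+1) * P) = r * L ('X^m * P) + L ('X^m * (('X - r%:P) * P)).
  by rewrite functional_mulXsubC; ring.
rewrite (le_trans (ler_normD _ _)) // normrM.
apply: le_trans (_ : `|r| * (K' * sigma ^+ m) + K * sigma ^+ m <= _).
  by rewrite lerD // ler_wpM2l.
rewrite exprS !mulrA -mulrDl ler_wpM2r ?exprn_ge0 ?(ltW sigma_gt0) //.
rewrite -lerBrDl [K' * sigma]mulrC -mulrBl mulrDr mulrCA divff ?gt_eqF //.
by rewrite mulr1 lerDr mulr_ge0 // ltW.
Qed.
End GeometricBounds.

(** Bernoulli's inequality reduces this to the Archimedean property of [R], available because K / (x
    - 1) is nonnegative and hence real. *)
Lemma geometric_unbounded (R : realType) (x K : R[i]) :
  1 < x -> (forall m, x ^+ m <= K) -> False.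
Proof.
move=> x_gt1 x_le.
have x1_gt0 : 0 < x - 1 by rewrite subr_gt0.
have bernoulli m : 1 + (x - 1) *+ m <= x ^+ m.
  elim: m => [|m IHm]; first by rewrite mulr0n addr0.
  rewrite exprS -[X in X * _](subrK 1) mulrDl mul1r mulrS addrCA.
  rewrite lerD // -[leLHS]mulr1 ler_pM2l //.
  by rewrite (le_trans _ IHm) // lerDl mulrn_wge0 // ltW.
pose t := complex.Re (K / (x - 1)).
have K_ge1 : 1 <= K by apply: x_le 0%N.
have K_real : 0 <= K / (x - 1) by rewrite divr_ge0 // ltW // (lt_le_trans ltr01).
have tE : K / (x - 1) = t%:C%C.
  by rewrite /t; move: K_real; case: (_ / _) => u v; rewrite lecE /= => /andP[/eqP->].
have t_ge0 : 0 <= t by move: K_real; rewrite tE lecR.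
have := archi_boundP t_ge0; rewrite -ltcR -tE ltr_pdivrMr // => K_lt.
have := le_trans (bernoulli (Num.Def.archi_bound t)) (x_le _).
rewrite -mulr_natl => leK.
suff : K < K by rewrite ltxx.
apply: lt_le_trans K_lt _; rewrite (le_trans _ leK) //.
by rewrite rmorph_nat lerDr.
Qed.

(** By induction on the roots, L kills all X^m (X - r) P. Hence L (X^m P) = r^m L P, which outgrows
    sigma^m unless L P = 0. *)
Lemma geometric_decay_eq0 (R : realType) (L : {scalar {poly R[i]}})
    (sigma K : R[i]) (rs : seq R[i]) (P : {poly R[i]}) : 0 < sigma ->
  {in rs, forall r, sigma < `|r|} ->
  (forall m, `|L ('X^m * P)| <= K * sigma ^+ m) ->
  (forall m, L ('X^m * (\prod_(r <- rs) ('X - r%:P) * P)) = 0) ->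
  forall m, L ('X^m * P) = 0.
Proof.
move=> sigma_gt0; elim: rs P K => [|r rs IHrs] P K rs_gt LP_le LP0.
  by move=> m; have := LP0 m; rewrite big_nil mul1r.
have r_gt : sigma < `|r| by rewrite rs_gt // inE eqxx.
have r_gt0 : 0 < `|r| := lt_trans sigma_gt0 r_gt.
have LrP0 : forall m, L ('X^m * (('X - r%:P) * P)) = 0.
  apply: (IHrs _ (K * sigma + `|r| * K)) => [s s_rs|m|m].
  - by apply: rs_gt; rewrite inE s_rs orbT.
  - rewrite functional_mulXsubC (le_trans (ler_normB _ _)) //.
    rewrite mulrDl lerD //; first by rewrite -mulrA -exprS.
    by rewrite normrM -mulrA ler_pM2l.
  - by have := LP0 m; rewrite big_cons -mulrA [('X - _) * _]mulrCA.
have LPE m : L ('X^m * P) = r ^+ m * L P.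
  elim: m => [|m IHm]; first by rewrite !expr0 !mul1r.
  have := LrP0 m; rewrite functional_mulXsubC => /eqP; rewrite subr_eq0 => /eqP->.
  by rewrite IHm exprS mulrA.
suff LP_eq0 : L P = 0 by move=> m; rewrite LPE LP_eq0 mulr0.
apply/eqP/negP => /negP LP_neq0.
apply: (@geometric_unbounded _ (`|r| / sigma) (K / `|L P|)).
  by rewrite ltr_pdivlMr // mul1r.
move=> m; rewrite ler_pdivlMr ?normr_gt0 // expr_div_n mulrAC.
by rewrite ler_pdivrMr ?exprn_gt0 // -normrX -normrM -LPE.
Qed.

(** The phase [s] may depend on [m] but not on [j]. So no cancellation occurs when L is applied to
    X^m P(X^2), and the leading term alone is bounded by the whole sum. *)
Lemma sign_periodic_annihilator (R : realType) (L : {scalar {poly R[i]}})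
    (sigma : R[i]) (rs ts : seq R[i]) : 0 < sigma ->
  {in rs, forall r, `|r| < sigma} ->
  {in ts, forall t, sigma < `|t| /\ ~~ (0 <= t ^+ 2)} ->
  (forall m, L ('X^m * (\prod_(r <- rs) ('X - r%:P)
                        * \prod_(t <- ts) ('X - t%:P))) = 0) ->
  (forall m, exists2 s, `|s| = 1 & forall j, 0 <= s * L 'X^(m + j * 2)) ->
  exists n, forall m, L ('X^m * ('X^n * \prod_(r <- rs) ('X - r%:P))) = 0.
Proof.
move=> sigma_gt0 rs_lt ts_gt L0 L_sign.
set B := \prod_(r <- rs) _ in L0 *; set C := \prod_(t <- ts) _ in L0.
have [t /ts_gt[]//|P [P_monic P_ge0 /dvdpP[Q PE]]] := @exists_nneg_multiple _ ts.
have [m|K K_ge0 LK] := geometric_upper_bound (L := L) (P := P \Po 'X^2) sigma_gt0 rs_lt.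
  rewrite PE -/B -/C (_ : _ * (B * _) = Q * 'X^m * (B * C)); last by ring.
  exact: annihilator_monomials.
(* The degree of P(X^2), whose leading monomial is X^n. *)
pose n := ((size P).-1 * 2)%N.
have LXn_le m : `|L ('X^m * 'X^n)| <= K * sigma ^+ m.
  apply: le_trans (LK m); have [s s1 sL] := L_sign m.
  rewrite -[leLHS]mul1r -[leRHS]mul1r -s1 -!normrM comp_polyE mulr_sumr linear_sum.
  rewrite mulr_sumr; under eq_bigr => i _.
    rewrite -exprM -scalerAr -exprD linearZ /= mulrCA [(2 * i)%N]mulnC.
    over.
  rewrite -exprD [leLHS]ger0_norm ?sL // [leRHS]ger0_norm; last first.
    by rewrite sumr_ge0 // => i _; rewrite mulr_ge0.
  have size_P : (0 < size P)%N by rewrite size_poly_gt0 monic_neq0.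
  have last_lt : ((size P).-1 < size P)%N by rewrite prednK.
  rewrite (bigD1 (Ordinal last_lt)) //= -lead_coefE (monicP P_monic) mul1r lerDl.
  by rewrite sumr_ge0 // => i _; rewrite mulr_ge0.
(* The constant comes from expanding B and applying [LXn_le] at rank m + i to its i-th term. *)
exists n; apply: (@geometric_decay_eq0 _ _ sigma
    (\sum_(i < size B) `|B`_i| * (K * sigma ^+ i)) ts) => //.
- by move=> t /ts_gt[].
- move=> m; rewrite mulrA -{1}[B]coefK poly_def mulr_sumr linear_sum mulr_suml.
  apply: le_trans (ler_norm_sum _ _ _) _; apply: ler_sum => i _.
  rewrite -scalerAr linearZ /= normrM -[leRHS]mulrA ler_wpM2l //.
  by rewrite -[leRHS]mulrA -[in leRHS]exprD addnC mulrAC -exprD LXn_le.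
- move=> m; rewrite -/C (_ : _ * (C * _) = 'X^n * 'X^m * (B * C)); last by ring.
  exact: annihilator_monomials.
Qed.

(** * Orbits of a map and the functional they define *)

Lemma monotonic_iter_even (R : realType) (J : interval R) (g : R -> R) :
  {homo g : x / x \in J} -> unstable.monotonic J g ->
  forall j, {in J &, {homo iter (j * 2) g : x y / x <= y}}.
Proof.
move=> g_into g_mono; elim=> // j IHj x y Jx Jy le_xy; rewrite mulSn /=.
have Jiter z m : z \in J -> iter m g z \in J.
  by move=> Jz; elim: m => //= m; apply: g_into.
have Jgiter z m : z \in J -> g (iter m g z) \in J by move=> Jz; rewrite g_into ?Jiter.
by case: g_mono => g_mono; rewrite !(Jiter, Jgiter, g_mono) ?IHj.
Qed.

Section OrbitFunctional.
Context {R : realType} (g : R -> R) (x : R).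

(** Complex coefficients allow characteristic polynomials to be split into linear factors;
    multiplication by ['X] corresponds to the shift along the orbit. *)
Definition orbit_functional (P : {poly R[i]}) : R[i] :=
  \sum_(j < size P) P`_j * (iter j g x)%:C%C.

Lemma orbit_functionalE (n : nat) (P : {poly R[i]}) : (size P <= n)%N ->
  orbit_functional P = \sum_(j < n) P`_j * (iter j g x)%:C%C.
Proof.
move=> le_n; rewrite /orbit_functional.
rewrite (big_ord_widen _ (fun j => P`_j * (iter j g x)%:C%C) le_n).
rewrite big_mkcond /=; apply: eq_bigr => i _.
by case: ltnP => // /(nth_default _) ->; rewrite mul0r.
Qed.

Fact orbit_functional_scalar : scalar orbit_functional.
Proof.
move=> c P Q /=; pose n := maxn (size P) (size Q).
rewrite !(@orbit_functionalE n) ?leq_maxl ?leq_maxr //; last first.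
  rewrite (leq_trans (size_polyD _ _)) // geq_max leq_maxr andbT.
  by rewrite (leq_trans (size_scale_leq _ _)) // leq_maxl.
rewrite mulr_sumr -big_split; apply: eq_bigr => i _ /=.
by rewrite coefD coefZ mulrDl mulrA.
Qed.

HB.instance Definition _ := GRing.isLinear.Build R[i] {poly R[i]} R[i] *%R
  orbit_functional orbit_functional_scalar.

Lemma orbit_functionalXn m : orbit_functional 'X^m = (iter m g x)%:C%C.
Proof.
rewrite /orbit_functional size_polyXn big_ord_recr /= coefXn eqxx mul1r.
by rewrite big1 ?add0r // => i _; rewrite coefXn ltn_eqF ?mul0r.
Qed.

Lemma orbit_functional_Xn_cpoly K (c : nat -> R) m :
  orbit_functional ('X^m * cpoly K c)
  = (\sum_(j < K.+1) c j * iter j g (iter m g x))%:C%C.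
Proof.
rewrite /cpoly poly_def mulr_sumr linear_sum rmorph_sum; apply: eq_bigr => j _.
rewrite -scalerAr -exprD linearZ /= orbit_functionalXn addnC iterD.
by rewrite rmorphM.
Qed.
End OrbitFunctional.

(** Since g maps I into itself, the equation may be used at every g^m(x), which yields the multiples
    of the polynomial by X^m. Conversely, Q = 1 gives back the equation at x. *)
Lemma iter_eqP (R : realType) (I : set R) K (c : nat -> R) g :
  (forall x, I x -> I (g x)) ->
  iter_eq I K c g <->
  forall x, I x -> forall Q, orbit_functional g x (Q * cpoly K c) = 0.
Proof.
move=> g_into; split=> [gc x Ix Q|gc x Ix].
  apply: annihilator_monomials => m /=; rewrite orbit_functional_Xn_cpoly gc //.
  by elim: m => //= m; apply: g_into.
have := gc x Ix 'X^0; rewrite orbit_functional_Xn_cpoly /=.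
by move/(congr1 (@complex.Re R)).
Qed.

(** * Common roots of two polynomials and separation of moduli *)

Lemma count_roots_scaled (F : fieldType) (c x : F) (rs : seq F) : c != 0 ->
  mup x (c *: \prod_(r <- rs) ('X - r%:P)) = count_mem x rs.
Proof.
by move=> c_neq0; rewrite -mul_polyC mupMr ?rootC // mu_prod_XsubC.
Qed.

(** Equal multiplicities at the roots of B split the root list of A, as a multiset, into the root
    list of B and the roots of A that are not roots of B. *)
Lemma factor_common_roots (F : closedFieldType) (A B : {poly F}) :
  A != 0 -> B != 0 -> {in root B, forall x, mup x A = mup x B} ->
  exists rs ts : seq F, exists c d : F,
    [/\ c != 0 /\ A = c *: (\prod_(r <- rs) ('X - r%:P) * \prod_(t <- ts) ('X - t%:P)),
        d != 0 /\ B = d *: \prod_(r <- rs) ('X - r%:P),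
        {in rs, forall r, root B r} & {in ts, forall t, root A t && ~~ root B t}].
Proof.
move=> A_neq0 B_neq0 mupAB.
have [us AE] := closed_field_poly_normal A.
have [rs BE] := closed_field_poly_normal B.
set c := lead_coef A in AE; set d := lead_coef B in BE.
have c_neq0 : c != 0 by rewrite lead_coef_eq0.
have d_neq0 : d != 0 by rewrite lead_coef_eq0.
have rootA x : root A x = (x \in us) by rewrite AE rootZ // root_prod_XsubC.
have rootB x : root B x = (x \in rs) by rewrite BE rootZ // root_prod_XsubC.
exists rs, [seq x <- us | ~~ root B x], c, d; split=> //; first split=> //.
- rewrite {1}AE -big_cat; congr (_ *: _); apply: perm_big; apply/allP => x _ /=.
  rewrite count_cat count_filter; apply/eqP.
  have [Bx|NBx] := boolP (root B x).
    rewrite -(count_roots_scaled x us c_neq0) -AE mupAB // [in LHS]BE count_roots_scaled //.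
    rewrite -[LHS]addn0; congr (_ + _)%N; apply/esym/eqP.
    rewrite -leqn0 leqNgt -has_count; apply/hasPn => y _ /=.
    by case: eqVneq => // ->; rewrite Bx.
  have -> : count_mem x rs = 0%N by apply/count_memPn; rewrite -rootB.
  rewrite add0n; apply: eq_count => y /=; case: eqVneq => // ->.
  by rewrite NBx.
- by move=> x; rewrite -rootB.
- by move=> x; rewrite mem_filter rootA andbC.
Qed.

Lemma size_cpoly (R : realType) K (c : nat -> R) : c K != 0 ->
  size (cpoly K c) = K.+1.
Proof. by move=> cK_neq0; rewrite size_poly_eq // fmorph_eq0. Qed.

(** By the orderings only the last lambda and the first mu matter, and their midpoint separates. The
    other cases treat empty families; without any lambda, mu != 0 keeps the radius positive. *)
Lemma exists_separating_radius (F : numFieldType) (p q : nat)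
    (lambda : 'I_p -> F) (mu : 'I_q -> F) :
  (forall i j : 'I_p, (i <= j)%N -> `|lambda i| <= `|lambda j|) ->
  (forall (i : 'I_p) (j : 'I_q), `|lambda i| < `|mu j|) ->
  (forall i j : 'I_q, (i <= j)%N -> `|mu i| <= `|mu j|) ->
  (forall j, mu j != 0) ->
  exists2 sigma : F, 0 < sigma &
    (forall i, `|lambda i| < sigma) /\ (forall j, sigma < `|mu j|).
Proof.
case: p q lambda mu => [|p] [|q] lambda mu lambda_le lambda_lt_mu mu_le mu_neq0.
- by exists 1 => //; split=> [[]|[]].
- exists (`|mu ord0| / 2); first by rewrite divr_gt0 ?normr_gt0.
  split=> [[]//|j]; rewrite (lt_le_trans _ (mu_le ord0 j _)) //.
  by rewrite ltr_pdivrMr // ltr_pMr ?normr_gt0 // ltr1n.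
- exists (`|lambda ord_max| + 1); first by rewrite ltr_wpDl.
  split=> [i|[]//]; rewrite (le_lt_trans (lambda_le i ord_max _)) ?ltrDl //.
  by rewrite -ltnS.
- have [lt1 lt2] := midf_lt (lambda_lt_mu ord_max ord0).
  exists ((`|lambda ord_max| + `|mu ord0|) / 2); first exact: le_lt_trans lt1.
  split=> [i|j]; first by rewrite (le_lt_trans (lambda_le i ord_max _)) // -ltnS.
  by rewrite (lt_le_trans lt2) // mu_le.
Qed.

(** * Non-real roots, injectivity, and removal of the factor C *)

Lemma conjc_id_of_sqr_ge0 (R : rcfType) (z : R[i]) : 0 <= z ^+ 2 -> z^*%C = z.
Proof.
case: z => x y; rewrite lecE expr2 /= => /andP[/eqP xy0 y_le].
suff -> : y = 0 by rewrite oppr0.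
apply/eqP; apply: contraT => y_neq0; move: y_le.
have /eqP : x * y = 0 by lra.
rewrite mulf_eq0 (negPf y_neq0) orbF => /eqP->; rewrite mul0r sub0r.
by rewrite oppr_ge0 leNgt -expr2 exprn_even_gt0 // y_neq0.
Qed.

(** If g x = g y, all iterates of positive order agree, so the equations at x and y differ only in
    the terms a_0 x and a_0 y. *)
Lemma iter_eq_inj (R : realType) (I : set R) N (a : nat -> R) (g : R -> R) :
  a 0%N != 0 -> iter_eq I N a g ->
  forall x y, I x -> I y -> g x = g y -> x = y.
Proof.
move=> a0_neq0 ga x y Ix Iy gxy; apply: (mulfI a0_neq0).
have iterE (j : 'I_N) : iter (lift ord0 j) g x = iter (lift ord0 j) g y.
  by rewrite lift0 !iterSr gxy.
have := etrans (ga x Ix) (esym (ga y Iy)); rewrite !big_ord_recl.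
by rewrite (eq_bigr _ (fun j _ => congr1 ( *%R _) (iterE j))) => /addIr.
Qed.

Lemma orbit_annihilator_reduce (R : realType) (J : interval R) (g : R -> R)
    (sigma : R[i]) (rs ts : seq R[i]) :
  {homo g : x / x \in J} -> unstable.monotonic J g -> 0 < sigma ->
  {in rs, forall r, `|r| < sigma} ->
  {in ts, forall t, sigma < `|t| /\ ~~ (0 <= t ^+ 2)} ->
  forall x, x \in J ->
  (forall Q, orbit_functional g x (Q * (\prod_(r <- rs) ('X - r%:P)
                                   * \prod_(t <- ts) ('X - t%:P))) = 0) ->
  forall Q, orbit_functional g x (Q * \prod_(r <- rs) ('X - r%:P)) = 0.
Proof.
move=> g_into g_mono sigma_gt0 rs_lt ts_gt x Jx L0.
set B := \prod_(r <- rs) _ in L0 *; set C := \prod_(t <- ts) _ in L0.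
(* Precomposing with multiplication by X - 1 turns the orbit into the sequence of its successive
   differences. *)
pose E : {poly R[i]} := 'X - 1.
pose L : {scalar {poly R[i]}} := orbit_functional g x \o GRing.mull_fun E idfun.
have [m|m|n Ln] := sign_periodic_annihilator (L := L) sigma_gt0 rs_lt ts_gt.
- by rewrite /= (mulrA E); apply: L0.
- have Jm : iter m g x \in J by elim: m => //= m; apply: g_into.
  have LE j : L 'X^(m + j * 2) =
      (iter (j * 2) g (g (iter m g x)) - iter (j * 2) g (iter m g x))%:C%C.
    rewrite /L /= /E mulrBl mul1r -exprS linearB /= !orbit_functionalXn.
    by rewrite -iterD addnC -iterS -iterSr -iterD rmorphB.
  (* Even iterates preserve order, so comparing g^m(x) with g^(m+1)(x) fixes the sign for every
     j. *)
  have [le_g|/ltW le_g] := leP (iter m g x) (g (iter m g x)).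
    exists 1; rewrite ?normr1 // => j; rewrite LE mul1r lecR subr_ge0.
    by apply: (monotonic_iter_even g_into) => //; apply: g_into.
  exists (-1); rewrite ?normrN1 // => j; rewrite LE mulN1r oppr_ge0 lecR subr_le0.
  by apply: (monotonic_iter_even g_into) => //; apply: g_into.
(* Used at y = 1 and y = 0, the roots of E X^n. *)
have ts_cop y : 0 <= y ^+ 2 -> coprimep ('X - y%:P) C.
  move=> y_ge0; rewrite coprimep_sym coprimep_XsubC root_prod_XsubC.
  by apply/negP => /ts_gt[_]; rewrite y_ge0.
have : coprimep (E * 'X^n) C.
  rewrite coprimepMl /E -polyC1 ts_cop ?expr1n //= coprimep_expl //.
  by rewrite -['X]subr0 -polyC0 ts_cop // expr0n.
move/Bezout_eq1_coprimepP => [[U V] /= UV1] Q.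
(* Of the two Bezout terms, the one with C B is killed by hypothesis and the one with E X^n B by the
   choice of n. *)
rewrite -[B]mul1r -UV1 mulrDl mulrDr linearD /=.
rewrite (_ : Q * (V * C * B) = Q * V * (B * C)); last by ring.
rewrite L0 addr0 (_ : Q * _ = E * (Q * U * ('X^n * B))); last by ring.
exact: (annihilator_monomials (L := L)).
Qed.

(** * Equivalence of the two iterative equations *)

Lemma roots_multP (R : realType) K (c : nat -> R) (s : seq (R[i] * nat)) z n :
  roots_mult K c = [set` s] ->
  (z, n) \in s <-> root (cpoly K c) z /\ n = mup z (cpoly K c).
Proof.
by move=> cs; change ([set` s] (z, n) <-> roots_mult K c (z, n)); rewrite cs.
Qed.

Lemma listingP (R : realType) p (lam : 'I_p -> R[i]) (l : 'I_p -> nat) z n :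
  reflect (exists i, z = lam i /\ n = l i) ((z, n) \in listing lam l).
Proof.
apply: (iffP mapP) => [[i _ [-> ->]]|[i [-> ->]]]; exists i => //.
by rewrite mem_enum.
Qed.

Theorem theorem3p3 (R : realType) (I : set R)
  (I_interval : is_interval I)
  (I_nondegenerate : exists x y : R, [/\ I x, I y & x < y])
  (N : nat) (a : nat -> R)
  (N_ge1 : (1 <= N)%N) (a0_neq0 : a 0%N != 0) (aN_neq0 : a N != 0)
  (p q : nat)
  (lambda : 'I_p -> R[i]) (l : 'I_p -> nat)
  (mu : 'I_q -> R[i]) (k : 'I_q -> nat)
  (roots_distinct :
    uniq (unzip1 (listing lambda l ++ listing mu k
                  ++ listing (fun j => (mu j)^*%C) k)))
  (roots_a :
    roots_mult N a =
      [set` listing lambda l ++ listing mu k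
            ++ listing (fun j => (mu j)^*%C) k])
  (lambda_le : forall i j : 'I_p, (i <= j)%N -> `|lambda i| <= `|lambda j|)
  (lambda_lt_mu : forall (i : 'I_p) (j : 'I_q), `|lambda i| < `|mu j|)
  (mu_le : forall i j : 'I_q, (i <= j)%N -> `|mu i| <= `|mu j|)
  (M : nat) (b : nat -> R) (bM_neq0 : b M != 0)
  (roots_b : roots_mult M b = [set` listing lambda l])
  (g : R -> R)
  (g_into : forall x, I x -> I (g x))
  (g_cont : {within I, continuous g}) :
  iter_eq I N a g <-> iter_eq I M b g.
Proof.
pose A := cpoly N a; pose B := cpoly M b.
have A_neq0 : A != 0 by rewrite -size_poly_gt0 size_cpoly.
have B_neq0 : B != 0 by rewrite -size_poly_gt0 size_cpoly.
have rootB z : root B z -> (z, mup z B) \in listing lambda l.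
  by move=> Bz; apply/(roots_multP _ _ roots_b).
have mupAB : {in root B, forall z, mup z A = mup z B}.
  move=> z /rootB Bz; symmetry.
  by have [] := (roots_multP z (mup z B) roots_a).1; rewrite ?mem_cat ?Bz.
(* A real mu_j would occur both among the mu and among their conjugates, against distinctness. *)
have mu_nonreal j : (mu j)^*%C != mu j.
  apply/eqP => mu_real; move: roots_distinct; rewrite /unzip1 !map_cat !cat_uniq.
  move=> /and3P[_ _ /and3P[_ /hasPn/(_ (mu j)) + _]].
  have mem_mu m : mu j = m j -> mu j \in [seq x.1 | x <- listing m k].
    move=> mE; apply/mapP; exists (mu j, k j) => //; apply/listingP.
    by exists j; rewrite -mE.
  by rewrite !mem_mu // => /(_ isT).
have [j|sigma sigma_gt0 [lambda_lt lt_mu]] :=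
    exists_separating_radius lambda_le lambda_lt_mu mu_le.
  by apply: contra_neq (mu_nonreal j) => ->; rewrite rmorph0.
have [rs [ts [c [d [[c_neq0 AE] [d_neq0 BE] rs_root ts_root]]]]] :=
  factor_common_roots A_neq0 B_neq0 mupAB.
have rs_lt : {in rs, forall r, `|r| < sigma}.
  by move=> r /rs_root/rootB/listingP[i [-> _]].
have ts_gt : {in ts, forall t, sigma < `|t| /\ ~~ (0 <= t ^+ 2)}.
  move=> t /ts_root/andP[At NBt].
  have : (t, mup t A) \in listing lambda l ++ listing mu k
                          ++ listing (fun j => (mu j)^*%C) k.
    exact/(roots_multP _ _ roots_a).
  rewrite !mem_cat => /or3P[tl|/listingP[j [-> _]]|/listingP[j [-> _]]].
  - by case/negP: NBt; have [] := (roots_multP t (mup t A) roots_b).1 tl.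
  - by split=> //; apply: contra (mu_nonreal j) => /conjc_id_of_sqr_ge0/eqP.
  - split; first by rewrite normcJ.
    apply: contra (mu_nonreal j) => /conjc_id_of_sqr_ge0 /eqP.
    by rewrite conjcK eq_sym.
(* The implication from b to a comes first: it only uses that B divides A. *)
rewrite !iter_eqP //; split=> [gA x Ix Q|gB x Ix Q]; last first.
  rewrite -/A (_ : Q * A = Q * (c / d)%:P * \prod_(t <- ts) ('X - t%:P) * B).
    exact: gB.
  rewrite AE BE -!mul_polyC polyCM.
  have dd : d^-1%:P * d%:P = 1 :> {poly R[i]} by rewrite -polyCM mulVf.
  set X := \prod_(r <- rs) _; set Y := \prod_(t <- ts) _.
  transitivity (Q * c%:P * X * Y * (d^-1%:P * d%:P)); last by ring.
  by rewrite dd; ring.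
(* Rewriting I as an [interval] gives access to the monotonicity of continuous injective
   functions. *)
have IE : I = [set` Rhull I] by rewrite RhullK // inE.
have g_mono : unstable.monotonic (Rhull I) g.
  apply: unstable.strict_monotonicW; apply: itv_continuous_inj_mono.
    by rewrite -IE.
  move=> y z Jy Jz; apply: (iter_eq_inj a0_neq0 (I := I) (N := N)).
  - exact/iter_eqP.
  - by rewrite IE.
  - by rewrite IE.
rewrite -/B BE -mul_polyC mulrA.
apply: (orbit_annihilator_reduce (J := Rhull I) (sigma := sigma) (ts := ts)) => //.
- move=> y Jy; have Iy : I y by rewrite IE.
  by have := g_into y Iy; rewrite [in X in X -> _]IE.
- by have := Ix; rewrite [in X in X -> _]IE.
move=> {}Q; have := gA x Ix (Q * c^-1%:P); rewrite -/A AE -mul_polyC -mulrA.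
by rewrite [c^-1%:P * _]mulrA -polyCM mulVf // polyC1 mul1r.
Qed.
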